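(* Let $K$ be a compact Hausdorff space and $B$ a linear subspace of $C(K)$ containing the constant function $1$, with $\dim B=N<\infty$. Let $L:B\to\mathbb{R}$ be a linear functional such that $L(1)=1=\|L\|$ and $L(b)\ge0$ for all $b\in B$ with $b\ge0$ on $K$. Then there exist $m\le N$, points $x_1,\dots,x_m\in K$ and $\lambda_1,\dots,\lambda_m\ge0$ with $\sum_{i=1}^m\lambda_i=1$ such that $$\mu:=\sum_{i=1}^m\lambda_i\delta_{x_i}$$ is a $K$-representing measure for $L$, i.e. $L(b)=\int b\,d\mu$ for all $b\in B$.
   Context: $C(K)$ is the algebra of continuous real-valued functions on $K$, with the supremum norm; $\|L\|$ is the operator norm of $L$ on $B$ with the supremum norm. $\delta_x$ is the Dirac measure at $x$. *)

(* Defs.v *)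
From HB Require Import structures.
From mathcomp Require Import all_boot all_order all_algebra.
From mathcomp Require Import all_classical all_reals all_analysis.

Set Implicit Arguments.
Unset Strict Implicit.
Unset Printing Implicit Defensive.

Import Order.TTheory GRing.Theory Num.Theory.
Import numFieldNormedType.Exports.

Local Open Scope classical_set_scope.
Local Open Scope ring_scope.

(* C(K) is the library type [continuousType K R] of bundled continuous
   functions, equipped below with its pointwise commutative ring structure
   (whose unit is the constant function 1) and R-module structure. *)
Section continuous_functions.
Context (K : topologicalType) (R : realType).

Definition cts_pred : {pred K -> R} := mem [set f : K -> R | continuous f].

Section Sub.
Context (f : K -> R) (fP : f \in cts_pred).
Definition cts_Sub_subproof := @isContinuous.Build K R f (set_mem fP).
#[local] HB.instance Definition _ := cts_Sub_subproof.
Definition cts_Sub : continuousType K R := f.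
End Sub.

Lemma cts_rect (P : continuousType K R -> Type) :
  (forall f (Pf : f \in cts_pred), P (cts_Sub Pf)) -> forall u, P u.
Proof.
move=> Psub [f [[Pf]]].
by suff -> : Pf = (set_mem (@mem_set _ [set f | _] f Pf)) by apply: Psub.
Qed.

Lemma cts_valP f (Pf : f \in cts_pred) : cts_Sub Pf = f :> (K -> R).
Proof. by []. Qed.

HB.instance Definition _ :=
  isSub.Build (K -> R) _ (continuousType K R) cts_rect cts_valP.

Lemma cts_subring_closed : subring_closed cts_pred.
Proof.
split=> [|f g|f g]; rewrite !inE /=.
- by move=> x; exact: cvg_cst.
- by move=> cf cg x; apply: cvgB; [exact: cf|exact: cg].
- by move=> cf cg x; apply: cvgM; [exact: cf|exact: cg].
Qed.

HB.instance Definition _ :=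
  GRing.isSubringClosed.Build (K -> R) cts_pred cts_subring_closed.

Lemma cts_scaler_closed : scaler_closed cts_pred.
Proof.
move=> a f; rewrite !inE /= => cf x.
by apply: cvgM; [exact: cvg_cst|exact: cf].
Qed.

HB.instance Definition _ :=
  GRing.isScaleClosed.Build R (K -> R) cts_pred cts_scaler_closed.

HB.instance Definition _ :=
  GRing.SubChoice_isSubComPzRing.Build (K -> R) cts_pred
    (continuousType K R) (subringClosedP _).
HB.instance Definition _ :=
  [SubZmodule_isSubLmodule of continuousType K R by <:].

End continuous_functions.

Section subspace.
Context (R : pzRingType) (V : lmodType R) (B : submodClosed V).

Definition subsp := {v : V | v \in B}.

HB.instance Definition _ := SubChoice.on subsp.
HB.instance Definition _ := [SubChoice_isSubLmodule of subsp by <:].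

End subspace.

Definition has_dim (R : pzRingType) (V : lmodType R) (n : nat) : Prop :=
  exists e : 'I_n -> V,
    (forall c : 'I_n -> R, \sum_i c i *: e i = 0 -> forall i, c i = 0) /\
    (forall v : V, exists c : 'I_n -> R, v = \sum_i c i *: e i).

(* On compact K the set is bounded, so that this real supremum is the usual
   one (the default value 0 of [sup] is used only for empty K). *)
Definition sup_norm (K : topologicalType) (R : realType)
  (f : continuousType K R) : R := sup (range (fun x => `|f x|)).

(* Extended-real valued: +oo if L is unbounded. *)
Definition op_norm (K : topologicalType) (R : realType)
    (B : submodClosed (continuousType K R)) (L : {scalar subsp B}) : \bar R :=
  ereal_sup [set `|L b|%:E | b in [set b : subsp B | sup_norm (val b) <= 1]].

(* The library's measurable types are pointed, hence [ptopologicalType] where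
   measures on K occur; this only assumes that K is nonempty. *)
Notation borelType K := (g_sigma_algebraType (@open K)).

Section dirac_combination.
Local Open Scope ereal_scope.
Context d (T : measurableType d) (R : realType) (m : nat).
Variables (lambda : 'I_m -> {nonneg R}) (x : 'I_m -> T).

Definition dirac_comb (A : set T) : \bar R :=
  \sum_(i < m) (lambda i)%:num%:E * \d_(x i) A.

Let summand (k : nat) : {measure set T -> \bar R} :=
  if insub k is Some i then mscale (lambda i) (dirac (x i)) else mzero.

Let dirac_combE : dirac_comb = msum summand m.
Proof.
apply/funext => A; apply: eq_bigr => i _.
by rewrite /summand valK.
Qed.

Let dirac_comb0 : dirac_comb set0 = 0.
Proof. by rewrite dirac_combE measure0. Qed.

Let dirac_comb_ge0 A : 0 <= dirac_comb A.
Proof. by rewrite dirac_combE. Qed.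

Let dirac_comb_sigma_additive : semi_sigma_additive dirac_comb.
Proof. by rewrite dirac_combE; exact: measure_semi_sigma_additive. Qed.

HB.instance Definition _ := isMeasure.Build _ _ _ dirac_comb
  dirac_comb0 dirac_comb_ge0 dirac_comb_sigma_additive.

End dirac_combination.

Definition representing (K : ptopologicalType) (R : realType)
    (B : submodClosed (continuousType K R))
    (mu : {measure set (borelType K) -> \bar R}) (L : {scalar subsp B}) : Prop :=
  forall b : subsp B, (L b)%:E = (\int[mu]_x (val b x)%:E)%E.

(* Main.v *)
Require Import Defs.
From HB Require Import structures.
From mathcomp Require Import all_boot all_order all_algebra.
From mathcomp Require Import all_classical all_reals all_analysis.
From mathcomp Require Import measurable_realfun.
From mathcomp Require Import ring lra.

Set Implicit Arguments.
Unset Strict Implicit.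
Unset Printing Implicit Defensive.

Import Order.TTheory GRing.Theory Num.Theory.
Import numFieldNormedType.Exports.

Local Open Scope classical_set_scope.
Local Open Scope ring_scope.

(** Let e_1, ..., e_N be a basis of B, let v_j be the function e_j on K, and let
    p = (L e_1, ..., L e_N). A combination of m Dirac measures represents L as
    soon as its moments against the v_j are the p_j, so p has to be written as
    a convex combination of N points of the compact set v(K) in R^N.

    Let q be a point nearest to p among the convex combinations of N points of
    v(K). It exists because these are the values of a continuous function on
    the compact space of N-tuples of (weight, point) pairs with weights of sum
    1 (Tychonoff's theorem, [compact_prob_weights]). The N-fold combinations
    form a convex set: moving q towards a point v(y) gives a combination of
    N + 1 points, and a linear dependency between N + 1 vectors of R^N removes
    one of them while keeping the coefficients nonnegative
    ([conic_caratheodory]). That the weights still have sum 1 comes for free: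
    as 1 lies in B, some linear form equals 1 on all of v(K), so that the mass
    of a combination can be read off its moments. This is why N points suffice
    and not only N + 1 ([prob_weights_reduction]).

    By minimality of the distance, <p - q, v(x) - q> <= 0 for all x
    ([dot_le0_of_closest]). The function <p - q, v(.)> of B is thus bounded by
    the constant <p - q, q>; since L is positive and L 1 = 1, it follows that
    <p - q, p> <= <p - q, q>, i.e. |p - q|^2 <= 0, and p = q
    ([moment_problem]). *)

(** * Caratheodory reduction *)

(** A nonnegative combination of n + 1 vectors of an n-dimensional space (the
    rows of [A]) can be rewritten with one coefficient equal to 0. *)
Lemma conic_caratheodory (R : realFieldType) (n : nat) (A : 'M[R]_(n.+1, n))
    (c : 'rV[R]_n.+1) :
  (forall i, 0 <= c 0 i) ->
  exists c' : 'rV[R]_n.+1, exists i0,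
    [/\ forall i, 0 <= c' 0 i, c' 0 i0 = 0 & c' *m A = c *m A].
Proof.
move=> c_ge0.
have [u uA [i1 ui1_gt0]] : exists2 u : 'rV[R]_n.+1, u *m A = 0 &
    exists i, 0 < u 0 i.
  have /rowV0Pn[u /sub_kermxP uA /rV0Pn[i]] : kermx A != 0.
    by rewrite -mxrank_eq0 mxrank_ker subn_eq0 -ltnNge ltnS rank_leq_col.
  rewrite neq_lt => /orP[ui|ui]; last by exists u => //; exists i.
  exists (- u); first by rewrite mulNmx uA oppr0.
  by exists i; rewrite mxE oppr_gt0.
(* The largest t such that c - t u is still nonnegative is the least ratio
   c_i / u_i with u_i > 0. *)
have [i0 ui0_gt0 t_min] : exists2 i0, 0 < u 0 i0 &
    forall i, 0 < u 0 i -> c 0 i0 / u 0 i0 <= c 0 i / u 0 i.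
  have := arg_minP (P := fun i => 0 < u 0 i) (fun i => c 0 i / u 0 i) ui1_gt0.
  by case=> i0; exists i0.
have t_ge0 : 0 <= c 0 i0 / u 0 i0 by rewrite divr_ge0 // ltW.
exists (c - (c 0 i0 / u 0 i0) *: u), i0; split=> [i||].
- rewrite !mxE subr_ge0; have [ui|ui] := ltP 0 (u 0 i).
    by rewrite -ler_pdivlMr //; exact: t_min.
  by apply: le_trans (c_ge0 i); exact: mulr_ge0_le0.
- by rewrite !mxE divfK ?subrr // gt_eqF.
- by rewrite mulmxBl -scalemxAl uA scaler0 subr0.
Qed.

(** First-order condition at a nearest point: if no subtraction of [t * d] with
    [t] in [0, 1] shortens [a], then the inner product of [a] and [d] is at
    most 0. *)
Lemma dot_le0_of_closest (R : realFieldType) (n : nat) (a d : 'I_n -> R) :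
  (forall t, 0 <= t <= 1 ->
     \sum_j a j ^+ 2 <= \sum_j (a j - t * d j) ^+ 2) ->
  \sum_j a j * d j <= 0.
Proof.
move=> a_min; set s := \sum_j _; pose Q := \sum_j d j ^+ 2.
have Q_ge0 : 0 <= Q by apply: sumr_ge0 => j _; exact: sqr_ge0.
have expand t : \sum_j (a j - t * d j) ^+ 2 =
    \sum_j a j ^+ 2 - 2 * t * s + t ^+ 2 * Q.
  rewrite !mulr_sumr -sumrB -big_split; apply: eq_bigr => j _ /=.
  by ring.
rewrite leNgt; apply/negP => s_gt0.
have sQ_gt0 : 0 < s + Q by rewrite ltr_pwDl.
(* A step at which the linear term -2ts outweighs the quadratic term t^2 Q, and
   which is at most 1. *)
pose t := s / (s + Q).
have t_gt0 : 0 < t by rewrite divr_gt0.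
have tE : t * (s + Q) = s by rewrite divfK // gt_eqF.
have t_le1 : t <= 1 by rewrite ler_pdivrMr // mul1r lerDl.
have := a_min t; rewrite (ltW t_gt0) t_le1 expand => /(_ isT).
have : 0 < t * s by rewrite mulr_gt0.
by nra.
Qed.

(** The integral of [v j] against the finite combination of Dirac measures with
    weights [(f i).1] at the points [(f i).2]. *)
Definition moment (R : pzRingType) (T : Type) (m n : nat) (v : 'I_n -> T -> R)
    (f : 'I_m -> R * T) (j : 'I_n) : R :=
  \sum_i (f i).1 * v j (f i).2.

(** The tuples of pairs (weight, point) whose weights are nonnegative and sum to
    1: those that encode a probability measure with at most n atoms. *)
Definition prob_weights (R : numDomainType) (T : Type) (n : nat) :
    set ('I_n -> R * T) :=
  [set f | (forall i, 0 <= (f i).1) /\ \sum_i (f i).1 = 1].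

(** When some linear form [a] is constantly 1 on the image of [v], the moment
    vectors of probability measures with at most n atoms form a set that is
    closed under moving towards a point of that image. *)
Lemma prob_weights_reduction (R : realFieldType) (T : Type) (n : nat)
    (v : 'I_n -> T -> R) (a : 'I_n -> R) (f : 'I_n -> R * T) (y : T) (t : R) :
  (forall x, \sum_j a j * v j x = 1) ->
  @prob_weights R T n f -> 0 <= t <= 1 ->
  exists2 g : 'I_n -> R * T, prob_weights g &
    forall j, moment v g j = (1 - t) * moment v f j + t * v j y.
Proof.
move=> av1 [f_ge0 f1] /andP[t_ge0 t_le1].
(* The n + 1 atoms of (1 - t) f + t (dirac y), with y in position 0. *)
pose h (i : 'I_n.+1) : R * T :=
  if unlift ord0 i is Some k then ((1 - t) * (f k).1, (f k).2) else (t, y).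
have [i|c [i0 [c_ge0 ci0 cA]]] := @conic_caratheodory _ _
    (\matrix_(i, j) v j (h i).2) (\row_i (h i).1).
  rewrite mxE /h; case: unliftP => [k _|_] //=.
  by rewrite mulr_ge0 // subr_ge0.
pose g k : R * T := (c 0 (lift i0 k), (h (lift i0 k)).2).
have gE j : moment v g j = (1 - t) * moment v f j + t * v j y.
  transitivity ((c *m (\matrix_(i, j) v j (h i).2)) 0 j).
    rewrite mxE (bigD1_ord i0) //= ci0 mul0r add0r.
    by apply: eq_bigr => k _; rewrite !mxE.
  rewrite cA mxE big_ord_recl !mxE /h unlift_none /= addrC mulr_sumr.
  by congr (_ + _); apply: eq_bigr => k _; rewrite !mxE liftK /= mulrA.
exists g => //; split=> [k|]; first exact: c_ge0.
(* The total mass is the combination of the moments with coefficients a. *)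
have massE (w : 'I_n -> R * T) : \sum_i (w i).1 = \sum_j a j * moment v w j.
  under [RHS]eq_bigr do rewrite mulr_sumr.
  rewrite exchange_big; apply: eq_bigr => i _ /=.
  rewrite -[LHS]mulr1 -(av1 (w i).2) mulr_sumr.
  by apply: eq_bigr => j _; ring.
rewrite massE; under eq_bigr do rewrite gE mulrDr.
rewrite big_split /=.
under eq_bigr do rewrite mulrCA.
under [X in _ + X]eq_bigr do rewrite mulrCA.
by rewrite -!mulr_sumr -massE f1 av1; ring.
Qed.

(** * Compactness and the nearest moment vector *)

(** Tuples of (weight, point) pairs, with the product topology. *)
Local Notation configurations R T n :=
  (prod_topology (fun _ : 'I_n => (R * T)%type)).

Lemma continuous_weight (R : realType) (T : topologicalType) (n : nat)
    (i : 'I_n) :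
  continuous (fun f : configurations R T n => (f i).1).
Proof.
move=> f; have cvg_i := @proj_continuous _ (fun=> R * T)%type i f.
exact: (cvg_comp _ _ cvg_i cvg_fst).
Qed.

Lemma continuous_point (R : realType) (T : topologicalType) (n : nat)
    (i : 'I_n) :
  continuous (fun f : configurations R T n => (f i).2).
Proof.
move=> f; have cvg_i := @proj_continuous _ (fun=> R * T)%type i f.
exact: (cvg_comp _ _ cvg_i cvg_snd).
Qed.

Lemma compact_prob_weights (R : realType) (T : topologicalType) (n : nat) :
  compact [set: T] ->
  compact (@prob_weights R T n : set (configurations R T n)).
Proof.
move=> cT.
have cbox : compact [set f : configurations R T n |
    forall i, ([set` `[0 : R, 1]] `*` [set: T]) (f i)].
  apply: (@tychonoff _ (fun=> R * T)%type (fun=> [set` `[0, 1]] `*` setT)).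
  by move=> i; apply: compact_setX => //; exact: segment_compact.
have cont_mass : continuous (fun f : configurations R T n => \sum_i (f i).1).
  apply: continuous_big => [|i _ f]; first exact: add_continuous.
  exact: continuous_weight.
have -> : @prob_weights R T n = [set f : configurations R T n |
    forall i, ([set` `[0 : R, 1]] `*` [set: T]) (f i)] `&`
    (fun f : configurations R T n => \sum_i (f i).1) @^-1` [set 1].
  apply/seteqP; split=> f /=.
    move=> [f_ge0 f1]; split=> // i; split=> //=.
    rewrite in_itv /= f_ge0 /= -f1 (bigD1 i) //= lerDl.
    by apply: sumr_ge0.
  move=> [f01 f1]; split=> // i.
  by have [/=] := f01 i; rewrite in_itv => /andP[].
apply: compact_closedI => //; apply: closed_comp => [f _|].
  exact: cont_mass.
exact: closed_eq.
Qed.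

Lemma continuous_moment (R : realType) (T : topologicalType) (m n : nat)
    (v : 'I_n -> T -> R) (j : 'I_n) :
  continuous (v j) ->
  continuous (fun f : configurations R T m => moment v f j).
Proof.
move=> cv; apply: continuous_big => [|i _ f]; first exact: add_continuous.
exact: (cvgM (@continuous_weight R T m i f)
             (cvg_comp _ _ (@continuous_point R T m i f) (cv _))).
Qed.

Lemma continuous_sqrB (R : realType) (T : topologicalType) (c : R)
    (f : T -> R) :
  continuous f -> continuous (fun x => (c - f x) ^+ 2).
Proof.
move=> cf x; have cvg_cf : (cst c - f) y @[y --> x] --> c - f x.
  by apply: cvgB; [exact: cvg_cst|exact: cf].
exact: (cvgM cvg_cf cvg_cf).
Qed.

(** When [T] is compact and the linear form [a] is constantly 1 on the image of
    the continuous map [v], a vector [p] is the moment vector of a probability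
    measure with at most n atoms as soon as it satisfies every affine inequality
    that holds on that image. *)
Lemma moment_problem (R : realType) (T : topologicalType) (n : nat)
    (v : 'I_n -> T -> R) (a p : 'I_n -> R) (x0 : T) :
  compact [set: T] -> (forall j, continuous (v j)) ->
  (forall x, \sum_j a j * v j x = 1) ->
  (forall (c : 'I_n -> R) (r : R), (forall x, \sum_j c j * v j x <= r) ->
     \sum_j c j * p j <= r) ->
  exists2 f : 'I_n -> R * T, prob_weights f & forall j, moment v f j = p j.
Proof.
move=> cT cv av1 p_le.
(* For n = 0 the sum in av1 is empty, hence 0 and not 1. *)
have n_gt0 : (0 < n)%N.
  rewrite lt0n; apply/eqP => n0; have /eqP := av1 x0.
  rewrite big1 ?(eq_sym 0) ?oner_eq0 // => j _.
  by have := ltn_ord j; rewrite [X in (_ < X)%N]n0.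
pose dist (f : configurations R T n) : R := \sum_j (p j - moment v f j) ^+ 2.
have cdist : continuous dist.
  apply: continuous_big => [|j _ f]; first exact: add_continuous.
  exact: (continuous_sqrB (@continuous_moment R T n n v j (cv j))).
have weights_neq0 : (@prob_weights R T n : set (configurations R T n)) !=set0.
  exists (fun k => ((k == Ordinal n_gt0)%:R, x0)); split=> [k|] /=.
    exact: ler0n.
  by rewrite (bigD1 (Ordinal n_gt0)) //= big1 ?addr0 // => k /negPf ->.
have [f /set_mem wf f_min] := compact_EVT_min weights_neq0
  (compact_prob_weights cT) (continuous_subspaceT cdist).
pose q := moment v f.
have q_max x : \sum_j (p j - q j) * (v j x - q j) <= 0.
  apply: dot_le0_of_closest => t t01.
  have [g wg gE] := prob_weights_reduction x av1 wf t01.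
  apply: le_trans (f_min g (mem_set wg)) _.
  rewrite le_eqVlt; apply/orP; left; apply/eqP.
  by apply: eq_bigr => j _; rewrite gE /q; congr (_ ^+ 2); ring.
have /p_le pq : forall x,
    \sum_j (p j - q j) * v j x <= \sum_j (p j - q j) * q j.
  move=> x; rewrite -subr_le0 -sumrB.
  by under eq_bigr do rewrite -mulrBr; exact: q_max.
have dist0 : \sum_j (p j - q j) ^+ 2 == 0.
  rewrite eq_le sumr_ge0 ?andbT => [|j _]; last exact: sqr_ge0.
  move: pq; rewrite -subr_le0 -sumrB.
  by under eq_bigr do rewrite -mulrBr -expr2.
exists f => // j; apply/esym/eqP; rewrite -subr_eq0 -sqrf_eq0.
move: dist0; rewrite psumr_eq0 => [/allP/(_ j)|i _]; last exact: sqr_ge0.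
by rewrite mem_index_enum => /(_ isT).
Qed.

(** * Evaluation in B and integration against Dirac combinations *)

Lemma ctsD_eval (R : realType) (K : topologicalType)
    (f g : continuousType K R) (x : K) : (f + g) x = f x + g x.
Proof. by []. Qed.

Lemma ctsZ_eval (R : realType) (K : topologicalType) (c : R)
    (f : continuousType K R) (x : K) : (c *: f) x = c * f x.
Proof. by []. Qed.

Lemma subsp_eval_sum (R : realType) (K : topologicalType)
    (B : submodClosed (continuousType K R)) (n : nat) (c : 'I_n -> R)
    (e : 'I_n -> subsp B) (x : K) :
  val (\sum_i c i *: e i) x = \sum_i c i * val (e i) x.
Proof.
rewrite linear_sum /=.
apply: (big_rec2 (fun (f : continuousType K R) (s : R) => f x = s)) => [//|].
by move=> i f s _ <-; rewrite ctsD_eval ctsZ_eval.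
Qed.

Lemma measurable_continuous_borel (K : ptopologicalType) (R : realType)
    (f : K -> R) :
  continuous f -> measurable_fun setT (f : borelType K -> R).
Proof.
move=> cf; apply: (measurability _ (RGenOpens.measurableE R)).
move=> _ [_ [a [b ->]] <-]; rewrite setTI.
apply: sub_sigma_algebra.
by apply: open_comp => [x _|]; [exact: cf|exact: interval_open].
Qed.

Lemma integral_dirac_comb d (T : measurableType d) (R : realType) (m : nat)
    (lambda : 'I_m -> {nonneg R}) (x : 'I_m -> T) (f : T -> R) :
  measurable_fun setT f ->
  (\int[dirac_comb lambda x]_y (f y)%:E)%E =
  (\sum_(i < m) (lambda i)%:num * f (x i))%:E.
Proof.
move=> mf.
have mEf : measurable_fun setT (EFin \o f) by exact/measurable_EFinP.
(* dirac_comb as a sum of measures indexed by nat: indices from m on, which the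
   sum does not reach, get the zero measure. *)
pose summand k : {measure set T -> \bar R} :=
  if insub k is Some i then mscale (lambda i) (dirac (x i)) else mzero.
(* Additivity of the integral in the measure is used for nonnegative functions,
   hence the split of f into its positive and negative parts. *)
have ge0_comb (g : T -> \bar R) : (forall y, 0 <= g y)%E ->
    measurable_fun setT g ->
    (\int[dirac_comb lambda x]_y g y =
     \sum_(i < m) (lambda i)%:num%:E * g (x i))%E.
  move=> g0 mg; transitivity (\int[msum summand m]_y g y)%E.
    apply: eq_measure_integral => A _ _ /=; apply: eq_bigr => i _.
    by rewrite /summand valK.
  rewrite ge0_integral_measure_sum //; apply: eq_bigr => i _.
  rewrite /summand valK ge0_integral_mscale // integral_dirac //.
  by rewrite diracT mul1e.
rewrite integralE !ge0_comb //; last 2 first.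
- exact: measurable_funeneg.
- exact: measurable_funepos.
under eq_bigr do rewrite funeposE -EFin_max -EFinM.
under [in X in (_ - X)%E]eq_bigr do rewrite funenegE -EFinN -EFin_max -EFinM.
rewrite !sumEFin -EFinB -sumrB; congr EFin; apply: eq_bigr => i _.
by rewrite -mulrBr -[in RHS](funrposBneg f).
Qed.

(** * Representation of a positive functional *)

Theorem theorem3p1 (R : realType) (K : ptopologicalType)
    (compactK : compact [set: K]) (hausdorffK : hausdorff_space K)
    (B : submodClosed (continuousType K R))
    (B1 : (1 : continuousType K R) \in B)
    (N : nat) (dimB : has_dim (subsp B) N)
    (L : {scalar subsp B})
    (L1 : L (Sub 1 B1) = 1)
    (normL : op_norm L = 1%E)
    (L_ge0 : forall b : subsp B, (forall x : K, 0 <= val b x) -> 0 <= L b) :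
  exists (m : nat) (x : 'I_m -> borelType K) (lambda : 'I_m -> {nonneg R}),
    [/\ (m <= N)%N,
        \sum_(i < m) (lambda i)%:num = 1 &
        representing (dirac_comb lambda x) L].
Proof.
have [e [_ e_span]] := dimB.
pose v j x := val (e j) x.
have cv j : continuous (v j) by exact: (@cts_fun _ _ (val (e j))).
have Lsum c : L (\sum_j c j *: e j) = \sum_j c j * L (e j).
  by rewrite linear_sum; apply: eq_bigr => j _; rewrite linearZ.
have [a aE] := e_span (Sub 1 B1).
have av1 x : \sum_j a j * v j x = 1.
  by rewrite -subsp_eval_sum -aE SubK.
have [c r cr|f [f_ge0 f1] fE] :=
    @moment_problem R K N v a (fun j => L (e j)) point compactK cv av1.
  (* L is applied to r 1 - sum_j c_j e_j, written in the basis e through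
     1 = sum_j a_j e_j. *)
  have /L_ge0 : forall x, 0 <= val (\sum_j (r * a j - c j) *: e j) x.
    move=> x; rewrite subsp_eval_sum.
    under eq_bigr do rewrite mulrBl -mulrA.
    by rewrite sumrB -mulr_sumr av1 mulr1 subr_ge0; exact: cr.
  rewrite Lsum; under eq_bigr do rewrite mulrBl -mulrA.
  by rewrite sumrB -mulr_sumr -Lsum -aE L1 mulr1 subr_ge0.
exists N, (fun i => (f i).2), (fun i => NngNum (f_ge0 i)); split=> // b.
have cb : continuous (val b : K -> R) by exact: cts_fun.
rewrite integral_dirac_comb; last exact: measurable_continuous_borel.
have [c ->] := e_span b; congr EFin; rewrite Lsum.
under [RHS]eq_bigr do rewrite subsp_eval_sum mulr_sumr.
rewrite exchange_big; apply: eq_bigr => j _; rewrite -fE mulr_sumr.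
by apply: eq_bigr => i _ /=; rewrite mulrCA.
Qed.
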